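(* Let $n\ge3$ be a fixed integer. For $\beta>0$ let $r(n,\beta)$ be a radius (radial coordinate) corresponding to an equilibrium position (critical point) of $U_\beta$, different from the origin, on a perpendicular bisector to the sides of the regular $n$-gon. Then $$\limsup_{\beta\to+\infty}r(n,\beta)\le\cos\left(\frac{\pi}{n}\right).$$
   Context: Positive unit point charges are placed at the vertices $\zeta_n^j=e^{2\pi i j/n}$, $j=1,\dots,n$, of a regular $n$-gon inscribed in the unit circle. For $\beta>0$ and $z=re^{i\theta}$ with $r\in[0,1)$, $\theta\in[0,2\pi)$, the Riesz potential is $$U_\beta(r,\theta)=\sum_{j=1}^n|z-\zeta_n^j|^{-2\beta}=\sum_{j=1}^n\frac{1}{(1+r^2-2r\cos(2\pi j/n-\theta))^{\beta}}.$$ It is regarded as a smooth function on the open unit disc in $\mathbb{R}^2\cong\mathbb{C}$; a critical point (equilibrium position) is a point of the open unit disc where its gradient vanishes. The perpendicular bisectors to the sides of the polygon are understood as the rays from the origin $\theta=\pi k/n$, $k=1,3,5,\dots,2n-1$. If there are several critical points different from the origin on the bisectors, $r(n,\beta)$ denotes an arbitrary choice among their radial coordinates. *)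

(* Defs.v *)
From mathcomp Require Import all_boot all_order all_algebra.
From mathcomp Require Import all_classical all_reals all_analysis.
From mathcomp Require Import ring.

Set Implicit Arguments.
Unset Strict Implicit.
Unset Printing Implicit Defensive.

Import Order.TTheory GRing.Theory Num.Theory.
Import numFieldNormedType.Exports.

Local Open Scope ring_scope.

(* The plane is R * R; its library norm is the max norm, so the Euclidean
   distance is defined separately. *)
Definition edist (R : realType) (p q : R * R) : R :=
  Num.sqrt ((p.1 - q.1) ^+ 2 + (p.2 - q.2) ^+ 2).

Definition polar (R : realType) (r theta : R) : R * R :=
  (r * cos theta, r * sin theta).

Definition zeta (R : realType) (n j : nat) : R * R :=
  polar 1 (2 * pi * j%:R / n%:R).

Definition potential (R : realType) (n : nat) (beta : R) (p : R * R) : R :=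
  \sum_(1 <= j < n.+1) edist p (zeta R n j) `^ (- (2 * beta)).

Definition gradient (R : realType) (f : R * R -> R) (p : R * R) : R * R :=
  ('D_((1, 0) : R * R) f p, 'D_((0, 1) : R * R) f p).

Definition critical_point (R : realType) (f : R * R -> R) (p : R * R) : Prop :=
  edist p (0, 0) < 1 /\ gradient f p = (0, 0).

Definition bisector_critical_radius (R : realType) (n : nat) (beta r : R) :
    Prop :=
  0 < r /\
  exists k : nat, [/\ odd k, (k <= 2 * n - 1)%N &
    critical_point (potential n beta) (polar r (pi * k%:R / n%:R))].

Lemma edist_polar_zeta (R : realType) (n j : nat) (r theta : R) :
  edist (polar r theta) (zeta R n j) ^+ 2 =
  1 + r ^+ 2 - 2 * r * cos (2 * pi * j%:R / n%:R - theta).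
Proof.
rewrite /edist /zeta /polar /= sqr_sqrtr; last by rewrite addr_ge0// sqr_ge0.
set a := _ / _; rewrite cosB !mul1r.
have e1 := cos2Dsin2 a; have e2 := cos2Dsin2 theta.
transitivity ((cos a ^+ 2 + sin a ^+ 2)
  + r ^+ 2 * (cos theta ^+ 2 + sin theta ^+ 2)
  - 2 * r * (cos a * cos theta + sin a * sin theta)); first by ring.
by rewrite e1 e2 mulr1.
Qed.

Lemma potential_polar (R : realType) (n : nat) (beta r theta : R) :
  potential n beta (polar r theta) =
  \sum_(1 <= j < n.+1)
    ((1 + r ^+ 2 - 2 * r * cos (2 * pi * j%:R / n%:R - theta)) `^ beta)^-1.
Proof.
rewrite /potential; apply: eq_bigr => j _.
rewrite -edist_polar_zeta powRN; congr _^-1.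
by rewrite powRrM powR_mulrn// sqrtr_ge0.
Qed.

(* Main.v *)
Require Import Defs.
From mathcomp Require Import all_boot all_order all_algebra.
From mathcomp Require Import all_classical all_reals all_analysis.
From mathcomp Require Import ring lra zify.

Import Order.TTheory GRing.Theory Num.Theory.
Import numFieldNormedType.Exports.
(* Takes [edist] back from the extended distance of MathComp-Analysis. *)
Import Defs.

Local Open Scope ring_scope.

(* The argument is non-asymptotic.  Up to a negative factor, the radial
   derivative of the potential at (r, theta) is the sum over the vertices of
   (r - cos phi_j) d_j^(-2 beta - 2), where phi_j is the angle between the
   point and the j-th vertex.  On a bisector every phi_j is an odd multiple of
   pi / n, so cos phi_j <= cos (pi / n): if r > cos (pi / n), all the summands
   are positive and the point is not critical. *)

(** Reduces directional derivatives in the plane to one real variable, where the chain rule for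
    [is_derive] applies. *)
Lemma derive_line (R : realType) (f : R * R -> R) (p v : R * R) :
  'D_v f p = 'D_1 (fun t : R => f (t *: v + p)) 0.
Proof.
rewrite /derive; set F := (X in (X @ _)%classic); set G := (X in _ = lim (X @ _)%classic).
suff -> : F = G by [].
apply/funext => h; rewrite /F /G /=.
by rewrite scale0r !add0r addr0 [h%:A]mulr1.
Qed.

Lemma edist_gt0 (R : realType) (p q : R * R) : p != q -> 0 < edist p q.
Proof.
move=> pq; rewrite sqrtr_gt0 lt_def addr_ge0 ?sqr_ge0// andbT.
rewrite paddr_eq0 ?sqr_ge0// !sqrf_eq0 !subr_eq0; apply: contra pq.
by case: p q => [? ?] [? ?] /= /andP[/eqP-> /eqP->].
Qed.

(** Chain rule through the squared distance [s]: since [p != q], [s 0] is positive, so both the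
    square root and the power are differentiable there. *)
Lemma is_derive_edist_powR (R : realType) (a : R) (p q v : R * R) : p != q ->
  is_derive (0 : R) 1 (fun t : R => edist (t *: v + p) q `^ a)
    (a * edist p q `^ (a - 1) / edist p q *
     ((p.1 - q.1) * v.1 + (p.2 - q.2) * v.2)).
Proof.
move=> pq; have d0 := edist_gt0 _ _ _ pq.
pose s t := (t * v.1 + p.1 - q.1) ^+ 2 + (t * v.2 + p.2 - q.2) ^+ 2.
have s0E : Num.sqrt (s 0) = edist p q by rewrite /s !mul0r !add0r.
have s0 : 0 < s 0 by rewrite -sqrtr_gt0 s0E.
have ds : is_derive (0 : R) 1 s
    (2 * ((p.1 - q.1) * v.1 + (p.2 - q.2) * v.2)).
  rewrite /s; apply: is_derive_eq.
  rewrite /GRing.scale /= !mul0r !add0r; ring.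
have dsqrt := is_derive1_comp (is_derive1_sqrt s0) ds.
have sq0 : 0 < (Num.sqrt \o s) 0 by rewrite /= s0E.
have dpow := is_derive1_comp (is_derive1_powR a sq0) dsqrt.
apply: is_derive_eq dpow _; rewrite /= s0E.
by field; rewrite gt_eqF.
Qed.

Lemma derive_potential (R : realType) (n : nat) (beta : R) (p v : R * R) :
  (forall j, p != zeta R n j) ->
  'D_v (potential n beta) p =
  \sum_(j < n) - (2 * beta) * edist p (zeta R n j.+1) `^ (- (2 * beta) - 1) /
    edist p (zeta R n j.+1) *
    ((p.1 - (zeta R n j.+1).1) * v.1 + (p.2 - (zeta R n j.+1).2) * v.2).
Proof.
move=> pz; rewrite derive_line.
pose h (j : 'I_n) (t : R) := edist (t *: v + p) (zeta R n j.+1) `^ (- (2 * beta)).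
have -> : (fun t : R => potential n beta (t *: v + p)) = \sum_(j < n) h j.
  apply/funext => t; rewrite /potential fct_sumE big_add1 /= big_mkord.
  by apply: eq_bigr.
apply: derive_val; apply: is_derive_sum => j.
exact: is_derive_edist_powR.
Qed.

(** Strong induction on [m]. For [m <= n] the cosine decreases on [[0, pi]] and oddness gives
    [1 <= m]; otherwise the reflection to [2 * n - m] or the shift to [m - 2 * n] keeps both the
    cosine and the parity. *)
Lemma cos_odd_le (R : realType) (n m : nat) : (0 < n)%N -> odd m ->
  cos (pi * m%:R / n%:R) <= cos (pi / n%:R) :> R.
Proof.
move=> n0; have n0' : 0 < n%:R :> R by rewrite ltr0n.
have ppi := pi_gt0 R.
elim/ltn_ind: m => m IH om.
have [mn|nm] := leqP m n.
  have m1 : 1 <= m%:R :> R by rewrite ler1n; lia.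
  have mn' : m%:R <= n%:R :> R by rewrite ler_nat.
  have n1 : 1 <= n%:R :> R by rewrite ler1n.
  have in1 : 0 <= (pi : R) / n%:R <= pi.
    by rewrite divr_ge0 ?(ltW ppi)//= ler_pdivrMr// ler_peMr ?(ltW ppi).
  have inm : 0 <= (pi : R) * m%:R / n%:R <= pi.
    rewrite divr_ge0 ?mulr_ge0 ?(ltW ppi)//=.
    by rewrite ler_pdivrMr// ler_wpM2l// ltW.
  rewrite leNgt ltr_cos ?in_itv//.
  by rewrite -leNgt ler_wpM2r ?invr_ge0 ?(ltW n0')// ler_peMr ?(ltW ppi).
have [m2|m2] := leqP m (2 * n).
  have -> : cos (pi * m%:R / n%:R) = cos (pi * (2 * n - m)%:R / n%:R) :> R.
    rewrite -cosN -(cosD2pi (- _)); congr cos.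
    by rewrite natrB// natrM mulr2n; field; rewrite gt_eqF.
  by apply: IH; lia.
have -> : cos (pi * m%:R / n%:R) = cos (pi * (m - 2 * n)%:R / n%:R) :> R.
  rewrite -[RHS]cosD2pi; congr cos.
  by rewrite natrB 1?ltnW// natrM mulr2n; field; rewrite gt_eqF.
by apply: IH; lia.
Qed.

(** The angle is [pi / n] times the odd integer [2 * j - k]; evenness of the cosine covers the
    negative case, where subtraction in [nat] would truncate. *)
Lemma cos_vertex_bisector_le (R : realType) (n j k : nat) : (0 < n)%N -> odd k ->
  cos (2 * pi * j%:R / n%:R - pi * k%:R / n%:R) <= cos (pi / n%:R) :> R.
Proof.
move=> n0 ok; have n0' : n%:R != 0 :> R by rewrite pnatr_eq0; lia.
have [kj|jk] := leqP k (2 * j).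
  have -> : 2 * pi * j%:R / n%:R - pi * k%:R / n%:R
      = pi * (2 * j - k)%:R / n%:R :> R.
    by rewrite natrB// natrM; field.
  by apply: cos_odd_le => //; lia.
rewrite -cosN.
have -> : - (2 * pi * j%:R / n%:R - pi * k%:R / n%:R)
    = pi * (k - 2 * j)%:R / n%:R :> R.
  by rewrite natrB 1?ltnW// natrM; field.
by apply: cos_odd_le => //; lia.
Qed.

Lemma bisector_critical_radius_le (R : realType) (n : nat) (beta r : R) :
  (0 < n)%N -> 0 < beta -> bisector_critical_radius n beta r ->
  r <= cos (pi / n%:R).
Proof.
move=> n0 b0 [r0 [k [ok _ [r1 grad0]]]].
rewrite leNgt; apply/negP => rcos.
set theta := pi * k%:R / n%:R in r1 grad0.
set p := polar r theta in r1 grad0.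
have {}r1 : r < 1.
  move: r1; rewrite /edist /= !subr0 !exprMn -mulrDr cos2Dsin2 mulr1.
  by rewrite sqrtr_sqr gtr0_norm.
(* At a vertex the squared distance would vanish, yet it is at least [(1 - r) ^+ 2], which is
   positive. *)
have pz j : p != zeta R n j.
  apply/eqP => pE; have := edist_polar_zeta n j r theta.
  rewrite -/p pE /edist !subrr expr0n addr0 sqrtr0 expr0n /=.
  have := cos_le1 (2 * pi * j%:R / n%:R - theta); nra.
move: grad0; rewrite /gradient !derive_potential// => -[] /= g1 g2.
pose c (j : 'I_n) := - (2 * beta) *
  edist p (zeta R n j.+1) `^ (- (2 * beta) - 1) / edist p (zeta R n j.+1).
have c_lt0 j : c j < 0.
  by rewrite /c !mulNr oppr_lt0 divr_gt0 ?mulr_gt0 ?powR_gt0 ?edist_gt0.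
pose phi (j : 'I_n) := 2 * pi * j.+1%:R / n%:R - theta.
(* The inner product of the gradient with [p], that is, [r] times the radial derivative. *)
have radial : \sum_(j < n) c j * (r * (r - cos (phi j))) = 0.
  have := congr2 (fun a b => p.1 * a + p.2 * b) g1 g2.
  rewrite /= !(mulr0 p.1) !(mulr0 p.2) addr0 !mulr_sumr -big_split /=.
  apply: etrans; apply: eq_bigr => j _.
  rewrite -/(c j) /phi cosB; set a := 2 * pi * _ / _.
  have e := cos2Dsin2 theta.
  set C := cos theta in e *; set S := sin theta in e *.
  (* Inserting [C ^+ 2 + S ^+ 2] turns the goal into a polynomial identity. *)
  have -> : r * (r - (cos a * C + sin a * S)) =
    r * (r * (C ^+ 2 + S ^+ 2) - (cos a * C + sin a * S)) by rewrite e mulr1.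
  by ring.
have neg j : c j * (r * (r - cos (phi j))) < 0.
  rewrite nmulr_rlt0// mulr_gt0// subr_gt0.
  exact: le_lt_trans (cos_vertex_bisector_le _ _ _ _ n0 ok) rcos.
have : \sum_(j < n) c j * (r * (r - cos (phi j))) < 0.
  (* One term is split off to make the inequality strict. *)
  rewrite (bigD1 (Ordinal n0))//= ltr_wnDr ?neg// sumr_le0// => j _.
  exact/ltW/neg.
by rewrite radial ltxx.
Qed.

Theorem theorem4p3 (R : realType) (n : nat) (hn : (3 <= n)%N)
  (r : R -> R)
  (hr : forall beta : R, 0 < beta -> bisector_critical_radius n beta (r beta)) :
  (limf_esup (fun beta : R => (r beta)%:E) (pinfty_nbhs R)
     <= (cos (pi / n%:R))%:E)%E.
Proof.
rewrite limf_esupE; apply: ge_ereal_inf.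
(* The limsup is an infimum over neighbourhoods of infinity; as the bound is uniform in [beta], the
   single neighbourhood [0 < beta] suffices. *)
exists (ereal_sup [set (r beta)%:E | beta in [set beta : R | 0 < beta]])%classic.
  exists [set beta : R | 0 < beta]%classic => //.
  exact: nbhs_pinfty_gt.
apply: ge_ereal_sup => _ [beta b0 <-]; rewrite lee_fin.
by apply: bisector_critical_radius_le (hr _ b0); [lia|].
Qed.
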